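(* Let $M$ be an infinite locally finite module over $\mathfrak{G} = \mathrm{Gal}(\overline{\mathbb{F}_q}/\mathbb{F}_q)$, which satisfies the Riemann Hypothesis Analogue with respect to $\mathbb{P}^1(\overline{\mathbb{F}_q})$. Then the polynomial $\zeta$-quotient $P_M(t) = \frac{\zeta_M(t)}{\zeta_{\mathbb{P}^1(\overline{\mathbb{F}_q})}(t)} = \sum_{j=0}^d a_j t^j \in \mathbb{Z}[t]$ of $M$ (of degree $d$) satisfies the functional equation $$P_M(t) = \mathrm{sign}(a_d)\, P_M\left(\frac{1}{q^{2\lambda}t}\right) q^{\lambda d} t^d \quad \text{for} \quad \lambda := \log_q \sqrt[d]{|a_d|}.$$
   Context: $\mathbb{F}_q$ is a finite field. A $\mathfrak{G}$-module is a set with an action of $\mathfrak{G}$; it is locally finite if all orbits are finite and for every $n\in\mathbb{N}$ there are at most finitely many orbits of cardinality $n$. The degree $\deg\nu$ of an orbit $\nu$ is its cardinality. The $\zeta$-function is $\zeta_M(t)=\prod_\nu\frac{1}{1-t^{\deg\nu}}$, the product over all $\mathfrak{G}$-orbits $\nu$ on $M$, and $\zeta_{\mathbb{P}^1(\overline{\mathbb{F}_q})}(t)=\frac{1}{(1-t)(1-qt)}$. $M$ satisfies the Riemann Hypothesis Analogue with respect to $\mathbb{P}^1(\overline{\mathbb{F}_q})$ if $P_M(t) = \zeta_M(t)/\zeta_{\mathbb{P}^1(\overline{\mathbb{F}_q})}(t)=\sum_{i=0}^d a_it^i=\prod_{i=1}^d(1-\omega_it)\in\mathbb{C}[t]$ is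 a polynomial with $|\omega_i|=\sqrt[d]{|a_d|}$ for all $1\le i\le d$. *)

(* Defs.v *)
From HB Require Import structures.
From mathcomp Require Import all_boot all_order all_algebra.
From mathcomp Require Import finmap.
From mathcomp Require Import boolp classical_sets functions cardinality.
From mathcomp Require Import reals exp.
From mathcomp Require Import complex.

Set Implicit Arguments.
Unset Strict Implicit.
Unset Printing Implicit Defensive.
Import Order.TTheory GRing.Theory Num.Theory.
Local Open Scope classical_set_scope.
Local Open Scope ring_scope.

(* [f n] is the coefficient of t^n. *)
Definition fps (R : Type) : Type := nat -> R.

HB.instance Definition _ (R : Type) := gen_eqMixin (fps R).
HB.instance Definition _ (R : Type) := gen_choiceMixin (fps R).

Section FormalPowerSeries.
Variable R : comUnitRingType.
Implicit Types (f g h : fps R) (p : {poly R}) (n : nat).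

Definition fps_add f g : fps R := fun n => f n + g n.
Definition fps_opp f : fps R := fun n => - f n.
Definition fps_zero : fps R := fun=> 0.
Definition fps_one : fps R := fun n => (n == 0)%:R.
Definition fps_mul f g : fps R := fun n => \sum_(i < n.+1) f i * g (n - i)%N.

Fact fps_addA : associative fps_add.
Proof. by move=> f g h; apply/funext=> n; rewrite /fps_add addrA. Qed.
Fact fps_addC : commutative fps_add.
Proof. by move=> f g; apply/funext=> n; rewrite /fps_add addrC. Qed.
Fact fps_add0 : left_id fps_zero fps_add.
Proof. by move=> f; apply/funext=> n; rewrite /fps_add add0r. Qed.
Fact fps_addN : left_inverse fps_zero fps_opp fps_add.
Proof. by move=> f; apply/funext=> n; rewrite /fps_add addNr. Qed.

HB.instance Definition _ :=
  GRing.isZmodule.Build (fps R) fps_addA fps_addC fps_add0 fps_addN.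

Definition fps_trunc n f : {poly R} := \poly_(i < n) f i.

Lemma fps_mul_trunc m n f g : (n < m)%N ->
  fps_mul f g n = (fps_trunc m f * fps_trunc m g)`_n.
Proof.
move=> nm; rewrite coefM; apply: eq_bigr => i _.
by rewrite !coef_poly (leq_ltn_trans _ nm) ?(leq_ltn_trans _ nm) ?leq_subr //
  -ltnS.
Qed.

Fact fps_mulC : commutative fps_mul.
Proof.
by move=> f g; apply/funext=> n; rewrite !(@fps_mul_trunc n.+1) // mulrC.
Qed.

Fact fps_mulA : associative fps_mul.
Proof.
move=> f g h; apply/funext=> n.
have E m u v w : (m <= n)%N ->
    (fps_trunc n.+1 (fps_mul u v) * w)`_m =
    (fps_trunc n.+1 u * fps_trunc n.+1 v * w)`_m.
  move=> mn; rewrite !coefM; apply: eq_bigr => -[i /= im] _.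
  have lin : (i < n.+1)%N by rewrite ltnS (leq_trans _ mn) // -ltnS.
  by rewrite coef_poly lin (fps_mul_trunc _ _ lin).
rewrite !(@fps_mul_trunc n.+1) // E //.
by rewrite [in LHS]mulrC E // [in LHS]mulrC mulrA.
Qed.

Fact fps_mul1 : left_id fps_one fps_mul.
Proof.
move=> f; apply/funext=> n; rewrite /fps_mul big_ord_recl /= mul1r subn0.
by rewrite big1 ?addr0 // => i _; rewrite /fps_one /= mul0r.
Qed.

Fact fps_mulDl : left_distributive fps_mul fps_add.
Proof.
move=> f g h; apply/funext=> n; rewrite /fps_mul /fps_add -big_split /=.
by apply: eq_bigr => i _; rewrite mulrDl.
Qed.

Fact fps_one_neq0 : fps_one != 0 :> fps R.
Proof.
by apply/eqP => /(congr1 (fun f : fps R => f 0)) /eqP; rewrite oner_eq0.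
Qed.

HB.instance Definition _ :=
  GRing.Zmodule_isComNzRing.Build (fps R)
    fps_mulA fps_mulC fps_mul1 fps_mulDl fps_one_neq0.

Definition fps_unit : {pred fps R} := fun f => f 0 \is a GRing.unit.

(* The first [n] coefficients g_0, ..., g_(n-1) of the inverse of [f], solved
   from the triangular system \sum_(i <= k) g_i f_(k - i) = (k == 0). *)
Fixpoint fps_inv_seq f n : seq R :=
  if n is k.+1 then
    let s := fps_inv_seq f k in
    rcons s (((k == 0)%:R - \sum_(i < k) s`_i * f (k - i)%N) / f 0)
  else [::].

Definition fps_inv f : fps R :=
  if f \in fps_unit then fun n => (fps_inv_seq f n.+1)`_n else f.

Lemma size_fps_inv_seq f n : size (fps_inv_seq f n) = n.
Proof. by elim: n => //= n IH; rewrite size_rcons IH. Qed.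

Lemma nth_fps_inv_seq f m n : (m < n)%N ->
  (fps_inv_seq f n)`_m = (fps_inv_seq f m.+1)`_m.
Proof.
elim: n => // n IH; rewrite ltnS leq_eqVlt => /orP[/eqP-> //|mn].
by rewrite [in LHS]/= nth_rcons size_fps_inv_seq mn IH.
Qed.

Fact fps_mulV : {in fps_unit, left_inverse 1 fps_inv *%R}.
Proof.
move=> f fU; apply/funext=> n.
rewrite -[RHS]/(fps_one n) -[LHS]/(fps_mul (fps_inv f) f n).
rewrite /fps_mul /fps_inv fU big_ord_recr /= subnn.
rewrite nth_rcons size_fps_inv_seq ltnn eqxx mulrVK //.
rewrite addrC -addrA (_ : - _ + _ = 0) ?addr0 //; apply/eqP.
rewrite addrC subr_eq0; apply/eqP/eq_bigr => i _; congr (_ * _).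
by rewrite [RHS]nth_fps_inv_seq.
Qed.

Fact fps_unitP f g : g * f = 1 -> f \in fps_unit.
Proof.
move=> /(congr1 (fun h : fps R => h 0)).
rewrite -[LHS]/(fps_mul g f 0) -[RHS]/(1 : R) /fps_mul big_ord1 subn0 => gf.
by apply/unitrPr; exists (g 0); rewrite mulrC.
Qed.

Fact fps_invout : {in [predC fps_unit], fps_inv =1 id}.
Proof. by move=> f /negbTE fU; rewrite /fps_inv fU. Qed.

HB.instance Definition _ :=
  GRing.ComNzRing_hasMulInverse.Build (fps R) fps_mulV fps_unitP fps_invout.

Definition fps_of_poly p : fps R := fun n => p`_n.

(* Unconditional t-adic product of the family [F] over the index set [A]: its
   n-th coefficient is the value at which the n-th coefficients of the finite
   subproducts stabilize along the finite subsets of [A] ordered by inclusion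
   (and 0 if they do not stabilize). *)
Definition fps_iprod (I : choiceType) (A : set I) (F : I -> fps R) : fps R :=
  fun n => xget 0 [set c | exists2 J : {fset I}, [set` J] `<=` A &
    forall J' : {fset I}, (J `<=` J')%fset -> [set` J'] `<=` A ->
      (\prod_(i <- J') F i : fps R) n = c].

Lemma fps_iprodE (I : choiceType) (A : set I) (F : I -> fps R) n
    (J : {fset I}) c : [set` J] `<=` A ->
  (forall J' : {fset I}, (J `<=` J')%fset -> [set` J'] `<=` A ->
     (\prod_(i <- J') F i : fps R) n = c) ->
  fps_iprod A F n = c.
Proof.
move=> JA Jc; apply: xget_unique; first by exists J.
move=> c' [J1 J1A J1c']; rewrite -(Jc (J `|` J1)%fset) ?fsubsetUl //; last first.
  by move=> i /=; rewrite inE => /orP[/JA|/J1A].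
rewrite J1c' ?fsubsetUr // => i /=; rewrite inE => /orP[/JA|/J1A] //.
Qed.

End FormalPowerSeries.

Section GaloisGroup.
Variables (F K : fieldType) (iota : {rmorphism F -> K}).

Record is_gal (s : K -> K) : Prop := IsGal {
  gal_bij : bijective s;
  gal_zmod : zmod_morphism s;
  gal_monoid : GRing.monoid_morphism s;
  gal_fix : forall a, s (iota a) = iota a }.

Record gal : Type := Gal { gal_fun :> K -> K; galP : is_gal gal_fun }.

HB.instance Definition _ := gen_eqMixin gal.
HB.instance Definition _ := gen_choiceMixin gal.

Lemma gal_inj (s u : gal) : s =1 u -> s = u.
Proof.
case: s u => s sP [u uP] /= /funext su; case: _ / su uP => uP.
by congr Gal; exact: Prop_irrelevance.
Qed.

Fact gal_one_subproof : is_gal id.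
Proof. by split=> //; exists id. Qed.
Definition gal_one : gal := Gal gal_one_subproof.

Fact gal_mul_subproof (s u : gal) : is_gal (s \o u).
Proof.
case: s u => s [bs zs [s1 sM] fs] [u [bu zu [u1 uM] fu]]; split => /=.
- exact: bij_comp.
- by move=> x y /=; rewrite zu zs.
- by split=> [|x y] /=; rewrite ?u1 ?s1 // uM sM.
- by move=> a; rewrite /= fu fs.
Qed.
(* Composition order: (s * u) x = s (u x). *)
Definition gal_mul (s u : gal) : gal := Gal (gal_mul_subproof s u).

Fact gal_inv_subproof (s : gal) :
  exists u : gal, cancel s u /\ cancel u s.
Proof.
case: s => s [bs zs [s1 sM] fs].
have [u su us] := bs.
suff uP : is_gal u by exists (Gal uP).
split.
- by exists s.
- by move=> x y; apply: (can_inj su); rewrite zs !us.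
- by split=> [|x y]; apply: (can_inj su); rewrite ?sM !us.
- by move=> a; rewrite -{1}(fs a) su.
Qed.
Definition gal_inv (s : gal) : gal := projT1 (cid (gal_inv_subproof s)).

Fact gal_mulA : associative gal_mul.
Proof. by move=> s u v; apply: gal_inj. Qed.
Fact gal_mul1g : left_id gal_one gal_mul.
Proof. by move=> s; apply: gal_inj. Qed.
Fact gal_mulg1 : right_id gal_one gal_mul.
Proof. by move=> s; apply: gal_inj. Qed.
Fact gal_mulVg : left_inverse gal_one gal_inv gal_mul.
Proof.
move=> s; apply: gal_inj => x /=.
by rewrite /gal_inv; case: cid => u [su us] /=; rewrite su.
Qed.
Fact gal_mulgV : right_inverse gal_one gal_inv gal_mul.
Proof.
move=> s; apply: gal_inj => x /=.
by rewrite /gal_inv; case: cid => u [su us] /=; rewrite us.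
Qed.

HB.instance Definition _ :=
  isGroup.Build gal gal_mulA gal_mul1g gal_mulg1 gal_mulVg gal_mulgV.

End GaloisGroup.

Section Modules.
Variables (G : groupType) (M : choiceType) (act : G -> M -> M).

Definition is_gaction : Prop :=
  (forall x, act 1%g x = x) /\
  (forall g h x, act (g * h)%g x = act g (act h x)).

Definition gorbit (x : M) : set M := range (act^~ x).

Definition gorbits : set (set M) := range gorbit.

(* [fset_set nu] is [nu] as a finite set; it is empty if [nu] is infinite. *)
Definition gdeg (nu : set M) : nat := #|` fset_set nu|.

Definition locally_finite : Prop :=
  (forall nu, gorbits nu -> finite_set nu) /\
  (forall n : nat, finite_set [set nu | gorbits nu /\ gdeg nu = n]).

Variable C : comUnitRingType.

Definition gzeta : fps C :=
  fps_iprod gorbits (fun nu => (fps_of_poly (1 - 'X^(gdeg nu)))^-1).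

Definition zetaP1 (q : nat) : fps C :=
  (fps_of_poly (1 - 'X) * fps_of_poly (1 - q%:R *: 'X))^-1.

Definition zeta_quotient (q : nat) : fps C := gzeta / zetaP1 q.

End Modules.

(* The modulus on the complex numbers R[i] with values in R is [Normc.normc];
   on nonnegative reals, x `^ d%:R^-1 is the d-th root of x for d > 0. *)
Definition RiemannHypothesisAnalogue (R : realType) (G : groupType)
    (M : choiceType) (act : G -> M -> M) (q : nat) : Prop :=
  exists (d : nat) (P : {poly R[i]}) (omega : 'I_d -> R[i]),
    [/\ zeta_quotient act R[i] q = fps_of_poly P,
        size P = d.+1,
        P = \prod_(i < d) (1 - omega i *: 'X)
      & forall i, Normc.normc (omega i) = Normc.normc P`_d `^ d%:R^-1].

(* Main.v *)
From HB Require Import structures.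
Require Import Defs.
From mathcomp Require Import all_boot all_order all_algebra.
From mathcomp Require Import finmap.
From mathcomp Require Import boolp classical_sets functions cardinality.
From mathcomp Require Import reals exp.
From mathcomp Require Import complex ring.

Import Order.TTheory GRing.Theory Num.Theory.
Local Open Scope classical_set_scope.
Local Open Scope ring_scope.

(** The functional equation comes from two symmetries of the multiset of the
    inverse roots [omega_i] of P, whose common modulus is called rho here.

    P has real coefficients, so complex conjugation permutes the [omega_i] and
    P is also the product of the factors [1 - omega_i^* t].  As all the
    [omega_i] have modulus rho, conjugation coincides on them with the
    inversion [omega |-> rho^2 / omega], and this inversion is what the
    substitution of [1 / (rho^2 t)] for [t] does to the linear factors:
    [(- omega^* ) * (1 - omega / (rho^2 t)) * t = 1 - omega^* t].
    Multiplying over i, the constants [- omega_i^*] collect into the conjugate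
    of the leading coefficient [a_d], that is into [a_d] itself.  This is
    [functional_eq_of_conj_invariant].  The definition of lambda amounts to
    [q^lambda = rho], so that [q^(2 lambda) = rho^2] and
    [sign(a_d) * q^(lambda d) = a_d].

    The coefficients of P are real because they are integers.  Each Euler
    factor of the zeta function is the inverse of an integral power series,
    and so is the zeta function of the projective line.  The passage from
    integral to complex power series is a ring morphism; it commutes with
    infinite products because the integers embed in the complex numbers, so
    that a coefficient of the partial products stabilizes over one ring if and
    only if it does over the other ([fps_map_iprod]).  Hence the zeta quotient
    is the image of one with integral coefficients ([fps_map_zeta_quotient]). *)

(** * Change of coefficients in formal power series *)

Section FpsMap.
Context {R S : comUnitRingType} (phi : {rmorphism R -> S}).

Definition fps_map (f : fps R) : fps S := fun n => phi (f n).

Fact fps_map_is_zmod_morphism : zmod_morphism fps_map.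
Proof. by move=> f g; apply/funext => n; rewrite /fps_map rmorphB. Qed.

Fact fps_map_is_monoid_morphism : GRing.monoid_morphism fps_map.
Proof.
split; first by apply/funext => n; rewrite /fps_map rmorph_nat.
move=> f g; apply/funext => n; rewrite /fps_map rmorph_sum.
by apply: eq_bigr => i _; rewrite rmorphM.
Qed.

HB.instance Definition _ :=
  GRing.isZmodMorphism.Build (fps R) (fps S) fps_map fps_map_is_zmod_morphism.
HB.instance Definition _ :=
  GRing.isMonoidMorphism.Build (fps R) (fps S) fps_map
    fps_map_is_monoid_morphism.

Lemma fps_map_of_poly (p : {poly R}) :
  fps_map (fps_of_poly p) = fps_of_poly (map_poly phi p).
Proof. by apply/funext => n; rewrite /fps_map /fps_of_poly coef_map. Qed.

(** The morphism commutes with finite products, so a coefficient that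
    stabilizes over R does so over S, at the image of the same value.  A
    coefficient that does not stabilize over R gets the default value 0;
    injectivity keeps it from stabilizing over S. *)
Lemma fps_map_iprod (I : choiceType) (A : set I) (F : I -> fps R) :
  injective phi ->
  fps_map (fps_iprod A F) = fps_iprod A (fun i => fps_map (F i)).
Proof.
move=> phi_inj; apply/funext => n; rewrite {1}/fps_map.
have prodE (J : {fset I}) :
    (\prod_(i <- J) fps_map (F i) : fps S) n
    = phi ((\prod_(i <- J) F i : fps R) n).
  by rewrite -rmorph_prod.
rewrite /fps_iprod; case: xgetP => [c _ [J JA Jc]|none].
  apply/esym/(@fps_iprodE _ _ _ _ _ J) => // J' JJ' J'A.
  by rewrite prodE (Jc J').
rewrite rmorph0 xgetPN // => c [J JA Jc].
apply: (none ((\prod_(i <- J) F i : fps R) n)); exists J => // J' JJ' J'A.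
by apply: phi_inj; rewrite -!prodE !Jc.
Qed.

(** In degree 0 the Euler factor is the inverse of the zero series, which is
    zero on both sides. *)
Lemma fps_map_euler_factor (n : nat) :
  fps_map (fps_of_poly (1 - 'X^n))^-1 = (fps_of_poly (1 - 'X^n))^-1.
Proof.
have mapE : fps_map (fps_of_poly (1 - 'X^n)) = fps_of_poly (1 - 'X^n).
  by rewrite fps_map_of_poly rmorphB rmorph1 /= map_polyXn.
case: n mapE => [|n] mapE.
  have e0 (T : comUnitRingType) : fps_of_poly (1 - 'X^0 : {poly T}) = 0.
    by rewrite expr0 subrr; apply/funext => m; rewrite /fps_of_poly coef0.
  by rewrite !e0 !invr0 rmorph0.
have unitE : fps_of_poly (1 - 'X^(n.+1) : {poly R}) \is a GRing.unit.
  change ((1 - 'X^(n.+1) : {poly R})`_0 \is a GRing.unit).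
  by rewrite coefB coef1 coefXn subr0 unitr1.
by rewrite -mapE rmorphV.
Qed.

Lemma fps_map_zeta_quotient (G : groupType) (M : choiceType)
    (act : G -> M -> M) (q : nat) :
  injective phi ->
  fps_map (zeta_quotient act R q) = zeta_quotient act S q.
Proof.
move=> phi_inj; rewrite /zeta_quotient /zetaP1 !invrK !rmorphM.
congr (_ * (_ * _)).
- rewrite -[LHS]/(fps_map _) /gzeta fps_map_iprod //; congr (fps_iprod _ _).
  by apply/funext => nu; rewrite fps_map_euler_factor.
- by rewrite -[LHS]/(fps_map _) fps_map_of_poly rmorphB rmorph1 /= map_polyX.
- by rewrite -[LHS]/(fps_map _) fps_map_of_poly rmorphB rmorph1 /= map_polyZ map_polyX rmorph_nat.
Qed.

End FpsMap.

(** * Polynomials whose inverse roots lie on a circle *)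

Section FunctionalEquation.
Context {C : numClosedFieldType} {d : nat}.
Variables (omega : 'I_d -> C) (rho : C).
Hypotheses (rho_neq0 : rho != 0) (norm_omega : forall i, `|omega i| = rho).
Let P := \prod_(i < d) (1 - omega i *: 'X).

Lemma lead_coef_prod_inverse_roots : lead_coef P = \prod_(i < d) - omega i.
Proof.
rewrite lead_coef_prod; apply: eq_bigr => i _.
have w0 : omega i != 0 by rewrite -normr_eq0 norm_omega.
rewrite addrC lead_coefDl.
  by rewrite lead_coefN lead_coefZ lead_coefX mulr1.
by rewrite size_polyN size_scale // size_polyX size_poly1.
Qed.

(** Invariance under conjugation allows P on the left and its leading
    coefficient on the right to be written with the [omega_i^*]; the equation
    then holds factor by factor, because [omega_i * omega_i^* = rho ^+ 2]. *)
Lemma functional_eq_of_conj_invariant (t : C) :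
  map_poly Num.conj P = P -> t != 0 ->
  P.[t] = lead_coef P * P.[1 / (rho ^+ 2 * t)] * t ^+ d.
Proof.
move=> conjP t0.
have -> : lead_coef P = \prod_(i < d) - (omega i)^*.
  rewrite -[in LHS]conjP lead_coef_map lead_coef_prod_inverse_roots rmorph_prod.
  by apply: eq_bigr => i _; rewrite rmorphN.
have factorE i :
    1 - (omega i)^* * t
    = - (omega i)^* * (1 - omega i * (1 / (rho ^+ 2 * t))) * t.
  have w0 : omega i != 0 by rewrite -normr_eq0 norm_omega.
  have wc0 : (omega i)^* != 0 by rewrite conjC_eq0.
  by rewrite -(norm_omega i) normCK; field; rewrite t0 w0 wc0.
rewrite -[in LHS]conjP rmorph_prod !horner_prod.
have -> : t ^+ d = \prod_(i < d) t by rewrite prodr_const card_ord.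
rewrite -!big_split; apply: eq_bigr => i _ /=.
rewrite rmorphB rmorph1 /= map_polyZ map_polyX !hornerD !hornerN !hornerZ.
by rewrite !hornerX !hornerC; exact: factorE.
Qed.

End FunctionalEquation.

(** * The functional equation of the zeta quotient *)

Lemma normc_intr (R : rcfType) (m : int) :
  Normc.normc (m%:~R : R[i]) = `|m|%:~R.
Proof.
have normE : `|m%:~R : R[i]| = (Normc.normc (m%:~R : R[i]))%:C%C.
  by rewrite normc_def; case: (m%:~R).
by apply: complexI; rewrite -normE -intr_norm rmorph_int.
Qed.

(** For [d = 0] the exponents [d^-1] and [lambda] are both 0, so the second
    equation forces the hypothesis on [x]. *)
Lemma powR_log_root (R : realType) (q x : R) (d : nat) :
  1 < q -> 0 < x -> (d = 0%N -> x = 1) ->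
  let lambda := ln (x `^ d%:R^-1) / ln q in
  q `^ (2 * lambda) = (x `^ d%:R^-1) ^+ 2 /\ q `^ (lambda * d%:R) = x.
Proof.
move=> q1 x0 xd lambda.
have q0 : 0 < q by rewrite (lt_trans _ q1).
have r0 : 0 < x `^ d%:R^-1 by rewrite powR_gt0.
have qE : q `^ lambda = x `^ d%:R^-1.
  rewrite /powR gt_eqF // /lambda divfK ?lnK //.
  by rewrite gt_eqF // ln_gt0.
split; first by rewrite mulrC powRrM qE powR_mulrn // ltW.
rewrite powRrM qE; case: d xd {lambda r0 qE} => [->|d _] //.
  by rewrite !powR1.
by rewrite -powRrM mulVf ?pnatr_eq0 ?powRr1 ?ltW.
Qed.

Theorem corollary31 (R : realType) (F : finFieldType) (K : closedFieldType)
    (iota : {rmorphism F -> K}) (K_algebraic : forall z : K, algebraicOver iota z)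
    (M : choiceType) (act : gal iota -> M -> M)
    (actM : is_gaction act)
    (infM : infinite_set [set: M])
    (finM : locally_finite act)
    (rhaM : RiemannHypothesisAnalogue R act #|F|) :
  exists (a : {poly int}),
    let P : {poly R[i]} := map_poly intr a in
    let d : nat := (size a).-1 in
    let q : R := #|F|%:R in
    let lambda : R := ln ((`|a`_d|%:~R : R) `^ d%:R^-1) / ln q in
    zeta_quotient act R[i] #|F| = fps_of_poly P /\
    forall t : R[i], t != 0 ->
      P.[t] = (Num.sg a`_d)%:~R * P.[1 / ((q `^ (2 * lambda))%:C%C * t)]
              * (q `^ (lambda * d%:R))%:C%C * t ^+ d.
Proof.
have intr_inj : injective (intr : int -> R[i]) by exact: intr_inj.
have [d [P [omega [zetaE sizeP PE normE]]]] := rhaM.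
pose a : {poly int} := \poly_(i < d.+1) zeta_quotient act int #|F| i.
have aP : map_poly intr a = P.
  apply/polyP => n; rewrite coef_map coef_poly.
  case: ltnP => [_|dn]; last by rewrite nth_default ?sizeP.
  rewrite -[RHS]/(fps_of_poly P n) -zetaE.
  by rewrite -(fps_map_zeta_quotient (intr : {rmorphism int -> R[i]})).
have size_a : size a = d.+1.
  by rewrite -sizeP -aP size_map_inj_poly.
exists a; rewrite aP size_a /=; split => // t t0.
have coefPd : P`_d = (a`_d)%:~R by rewrite -aP coef_map.
have a_neq0 : a`_d != 0.
  by rewrite -[d]/(d.+1.-1) -size_a -lead_coefE lead_coef_eq0 -size_poly_eq0 size_a.
have norm_a_gt0 : 0 < `|a`_d|%:~R :> R by rewrite ltr0z normr_gt0.
have norm_a_d0 : d = 0%N -> `|a`_d|%:~R = 1 :> R.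
  move=> d0; rewrite -normc_intr -coefPd d0 PE big1 ?coef1 ?Normc.normc1 //.
  by move=> i _; have := ltn_ord i; rewrite [X in (_ < X)%N]d0 ltn0.
have q_gt1 : 1 < #|F|%:R :> R by rewrite ltr1n card_finNzRing_gt1.
have [-> ->] := powR_log_root _ _ _ _ q_gt1 norm_a_gt0 norm_a_d0.
set rho := _ `^ _.
have rho_gt0 : 0 < rho by rewrite powR_gt0.
have norm_omega i : `|omega i| = rho%:C%C.
  rewrite normc_def /rho -normc_intr -coefPd -(normE i).
  by case: (omega i).
have conjP : map_poly Num.conj P = P.
  by rewrite -aP; apply/polyP => n; rewrite !coef_map /= rmorph_int.
have rho_neq0 : rho%:C%C != 0 by rewrite fmorph_eq0 gt_eqF.
have PdE : lead_coef P = (Num.sg a`_d)%:~R * (`|a`_d|%:~R : R)%:C%C.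
  rewrite lead_coefE sizeP coefPd {1}[a`_d]numEsg intrM; congr (_ * _).
  by rewrite rmorph_int.
have := @functional_eq_of_conj_invariant _ _ omega _ rho_neq0 norm_omega t.
rewrite -PE => -> //; rewrite PdE rmorphXn.
by congr (_ * _); rewrite mulrAC.
Qed.
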